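(* Let $\mathcal{F}$ be a partition regular family of finite subsets of $\mathbb{N}$ which contains no singletons, and let $\Sigma$ be a finite alphabet. For any finite colouring of $L(\Sigma)$ there exist $\alpha\in L(\Sigma)$, $\gamma\in \mathcal{P}_f(\mathbb{N})$ and $F\in \mathcal{F}$ such that ${\it dom}\,\alpha$, $\gamma$ and $F$ are pairwise disjoint and $$\big\{\alpha \cup \big((\gamma \cup \{t\}) \times \{s\}\big) : s\in \Sigma,\ t\in F \big\}$$ is monochrome.
   Context: An alphabet $\Sigma$ is a finite nonempty set. A located word over $\Sigma$ is a function $\alpha$ from a finite set ${\it dom}\,\alpha\subset\mathbb{N}$ to $\Sigma$; functions are viewed as sets of ordered pairs, so that for located words (or finite sets of pairs) with disjoint domains their union is again a located word. $L(\Sigma)$ denotes the set of all located words over $\Sigma$. $\mathcal{P}_f(\mathbb{N})$ is the set of finite nonempty subsets of $\mathbb{N}$. A family $\mathcal{F}$ of subsets of $\mathbb{N}$ is partition regular if for any finite colouring of $\mathbb{N}$ some $F\in\mathcal{F}$ is monochrome. *)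

(* Defs.v *)
From mathcomp Require Import all_boot.
From mathcomp Require Export finmap.
From mathcomp Require Import classical_sets.

Set Implicit Arguments.
Unset Strict Implicit.
Unset Printing Implicit Defensive.

Local Open Scope fset_scope.
Local Open Scope classical_set_scope.

(* A finite colouring of T is a map c : T -> 'I_r for some r. *)
Definition monochrome (T : Type) (r : nat) (c : T -> 'I_r) (A : set T) : Prop :=
  exists k : 'I_r, forall x, A x -> c x = k.

Definition partition_regular (FF : set {fset nat}) : Prop :=
  forall (r : nat) (c : nat -> 'I_r),
    exists2 F : {fset nat}, FF F & monochrome c [set` F].

(* Finite maps are extensional, so equality in this type is equality of
   partial functions; the empty word is included. *)
Definition located_word (Sigma : finType) : Type := {fmap nat -> Sigma}.

(* The located word A * {s}. *)
Definition const_word (Sigma : finType) (A : {fset nat}) (s : Sigma) :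
    located_word Sigma :=
  [fmap _ : A => s].

(* The right-biased union of finite maps, which for disjoint domains is the
   union of the graphs. *)
Definition word_union (Sigma : finType) (a b : located_word Sigma) :
    located_word Sigma :=
  (a + b)%fmap.

(* Main.v *)
(* Take n from the Hales-Jewett theorem for Sigma and r colours.  Put the j-th
   letter of a word w of length n at two positions: j itself and a further
   position t_j.  A Fubini-type argument gives disjoint members F_0, ..., F_(n-1)
   of FF such that, as long as t_j lies in F_j for every j, the colour depends on
   w only.  To iterate, one needs a limit of the colours c(t, x) as t varies:
   it comes from a decreasing sequence of sets on which FF is still partition
   regular.  Hales-Jewett yields a monochrome line; choosing a variable letter i
   of it and letting only t_i vary in F_i gives the configuration, and gamma is
   nonempty because it contains the position i. *)
Require Import Defs.
From mathcomp Require Import all_boot finmap classical_sets.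
From mathcomp Require Import boolp.

Set Implicit Arguments.
Unset Strict Implicit.
Unset Printing Implicit Defensive.

Local Open Scope fset_scope.
Local Open Scope classical_set_scope.

(** * The Hales-Jewett theorem by colour focusing *)

Section HalesJewett.
Variable A : eqType.

(** [None] marks the variable letter. *)
Definition line_at (l : seq (option A)) (s : A) : seq A := map (odflt s) l.

Definition combinatorial_line (n : nat) (l : seq (option A)) : Prop :=
  size l = n /\ None \in l.

(** Only letters of [S] must agree, while [C] colours words over all of [A]; this allows induction
    on the letters. *)
Definition hales_jewett_on (S : seq A) : Prop :=
  forall K : finType, exists n, forall C : seq A -> K,
    exists2 l, combinatorial_line n l &
      {in S &, forall s s', C (line_at l s) = C (line_at l s')}.

(* The lines have a common endpoint at [a] and distinct colours along [S]: with
   more lines than colours this is impossible. *)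
Definition focused (n : nat) (K : eqType) (C : seq A -> K) (S : seq A) (a : A)
    (f : seq A) (ls : seq (seq (option A) * K)) : Prop :=
  [/\ size f = n, uniq (unzip2 ls)
    & {in ls, forall p, [/\ combinatorial_line n p.1, line_at p.1 a = f
                          & {in S, forall s, C (line_at p.1 s) = p.2}]}].

Lemma line_at_cat l1 l2 s : line_at (l1 ++ l2) s = line_at l1 s ++ line_at l2 s.
Proof. exact: map_cat. Qed.

Lemma line_at_Some w s : line_at (map Some w) s = w.
Proof. by rewrite /line_at -map_comp map_id. Qed.

End HalesJewett.

Section HalesJewettProof.
Variable A : finType.

Lemma focusing (S : seq A) (a : A) (K : finType) (m : nat) :
  hales_jewett_on S -> exists n, forall C : seq A -> K,
    (exists2 l, combinatorial_line n l &
       {in a :: S, forall s, C (line_at l s) = C (line_at l a)})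
    \/ (exists f ls, size ls = m /\ focused n C S a f ls).
Proof.
move=> HJ; elim: m => [|m [n IHn]].
  by exists 0 => C; right; exists [::], [::].
(* A suffix is coloured by the whole colouring it induces on prefixes, so along [L] the letters of
   [S] become interchangeable for all prefixes at once. *)
have [N HN] := HJ {ffun n.-tuple A -> K}.
exists (n + N)%N => C.
have [L [sL NL] monoL] := HN (fun v => [ffun w : n.-tuple A => C (w ++ v)]).
pose s0 := head a S.
have CL w s : size w = n -> s \in S -> C (w ++ line_at L s) = C (w ++ line_at L s0).
  move=> /eqP sw sS; have s0S : s0 \in S.
    by rewrite /s0; case: (S) sS => //= b S' _; rewrite mem_head.
  by have /ffunP/(_ (Tuple sw)) := monoL s s0 sS s0S; rewrite !ffunE.
have lineL l : combinatorial_line n l ->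
    combinatorial_line (n + N)%N (l ++ map Some (line_at L s0)).
  by move=> [sl Nl]; split; rewrite ?size_cat ?size_map ?sl ?sL // mem_cat Nl.
have [[l ll monol]|[f [ls [sls [sf uls fls]]]]] :=
    IHn (fun w => C (w ++ line_at L s0)).
  left; exists (l ++ map Some (line_at L s0)); first exact: lineL.
  by move=> s sS; rewrite !line_at_cat !line_at_Some monol.
pose k0 := C (f ++ line_at L s0).
(* If the focus has the colour of one of the lines, that line is monochrome including its endpoint
   at [a]. *)
have [/mapP[[l k] lkls /= k0E]|k0N] := boolP (k0 \in unzip2 ls).
  have [/= ll lf lS] := fls _ lkls.
  left; exists (l ++ map Some (line_at L s0)); first exact: lineL.
  move=> s; rewrite !line_at_cat !line_at_Some inE lf => /orP[/eqP->|sS].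
    by rewrite lf.
  by rewrite lS // -k0E.
(* Old lines now vary in both blocks; the new one fixes the prefix [f], varies along [L] and brings
   the new colour [k0]. *)
right; exists (f ++ line_at L a).
exists ((map Some f ++ L, k0) :: [seq (p.1 ++ L, p.2) | p <- ls]).
split; first by rewrite /= size_map sls.
split; first by rewrite size_cat size_map sf sL.
  by rewrite /= /unzip2 -map_comp k0N.
move=> p; rewrite inE => /orP[/eqP->|/mapP[[l k] lkls ->]] /=.
  split; first by split; rewrite ?size_cat ?size_map ?sf ?sL // mem_cat NL orbT.
    by rewrite line_at_cat line_at_Some.
  by move=> s sS; rewrite line_at_cat line_at_Some CL.
have [/= [sl Nl] lf lS] := fls _ lkls.
split; first by split; rewrite ?size_cat ?sl ?sL // mem_cat Nl.
  by rewrite line_at_cat lf.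
by move=> s sS; rewrite line_at_cat CL ?lS // size_map.
Qed.

Lemma hales_jewett_onP (S : seq A) : hales_jewett_on S.
Proof.
elim: S => [|a S IHS] K; first by exists 1 => C; exists [:: None].
have [n Hn] := focusing a K #|K|.+1 IHS.
exists n => C; have [[l ll monol]|[f [ls [sls [_ uls _]]]]] := Hn C.
  by exists l => // s s' sS s'S; rewrite !monol.
by have := max_card (mem (unzip2 ls)); rewrite (card_uniqP uls) size_map sls ltnn.
Qed.

Theorem hales_jewett (K : finType) : exists n, forall C : seq A -> K,
  exists2 l, combinatorial_line n l &
    forall s s', C (line_at l s) = C (line_at l s').
Proof.
have [n Hn] := hales_jewett_onP (enum A) K; exists n => C.
by have [l ll lC] := Hn C; exists l => // s s'; apply: lC; rewrite mem_enum.
Qed.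

End HalesJewettProof.

(** * Large sets, limits and monochrome boxes *)

Section Large.
Variable FF : set {fset nat}.

(* The complements of the non-large sets behave like a filter; repeatedly
   splitting large sets replaces taking limits along an ultrafilter. *)
Definition large (S : set nat) : Prop :=
  forall (K : finType) (c : nat -> K), exists F k,
    FF F /\ {in F, forall t, S t /\ c t = k}.

Lemma large_setT : partition_regular FF -> large setT.
Proof.
move=> FF_pr K c.
have [F FFF [k Fk]] := FF_pr #|K| (fun t => enum_rank (c t)).
exists F, (enum_val k); split=> // t tF; split=> //.
by rewrite -(Fk t tF) enum_rankK.
Qed.

(** If each fibre of [f] had a bad colouring [c k], colouring [t] by [f t] together with its colour
    under [c (f t)] would be bad for [S]. The palettes vary with [k], hence the dependent pairs. *)
Lemma large_split (S : set nat) (K : finType) (f : nat -> K) :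
  large S -> exists k, large [set t | S t /\ f t = k].
Proof.
move=> largeS; apply: contrapT => /forallNP Nlarge.
have /choice[c cP] : forall k, exists c : {L : finType & nat -> L},
    forall F (l : projT1 c), FF F ->
      ~ {in F, forall t, (S t /\ f t = k) /\ projT2 c t = l}.
  move=> k; have /existsNP[L /existsNP[c Hc]] := Nlarge k.
  by exists (existT _ L c) => F l FFF Fl; apply: Hc; exists F, l.
pose d t : {k : K & projT1 (c k)} :=
  existT (fun k => projT1 (c k)) (f t) (projT2 (c (f t)) t).
have [F [[k l] [FFF Fd]]] := largeS _ d.
apply: (cP k F l FFF) => t tF; have [St dt] := Fd t tF.
have ftk : f t = k by exact: (congr1 tag dt).
split=> //; move: dt; rewrite /d ftk => /eqP.
by rewrite eq_Tagged => /eqP.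
Qed.

Lemma large_limit (T : countType) (K : finType) (f : T -> nat -> K) :
  partition_regular FF -> exists g : T -> K,
    forall X : seq T, large [set t | {in X, forall x, f x t = g x}].
Proof.
move=> FF_pr.
have [[x0]|noT] := pselect (inhabited T); last first.
  exists (fun x => match noT (inhabits x) with end) => X K' c.
  have [F [k [FFF Fk]]] := large_setT FF_pr c.
  exists F, k; split=> // t tF; split; last by have [] := Fk t tF.
  by move=> x; case: (noT (inhabits x)).
(* Numbers coding no element of [T] are sent to [x0]. *)
pose h (i : nat) := f (odflt x0 (choice.unpickle i)).
have /choice[kap kapP] : forall p : nat * set nat, exists k,
    large p.2 -> large [set t | p.2 t /\ h p.1 t = k].
  move=> [i S]; have [lS|] := pselect (large S).
    by have [k] := large_split (h i) lS; exists k.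
  by exists (h 0 0).
(* Passing to [B j.+1] makes [h j] constant; a finite [X] is settled one stage past its largest
   code. *)
pose B := fix B i := if i is j.+1
  then [set t | B j t /\ h j t = kap (j, B j)] else setT.
have largeB i : large (B i).
  by elim: i => [|i IHi]; [exact: large_setT | exact: (kapP (i, B i))].
have hB i m t : i < m -> B m t -> h i t = kap (i, B i).
  elim: m => // m IHm; rewrite ltnS leq_eqVlt => /orP[/eqP->|im] [] //.
  by move=> /IHm - /(_ im).
exists (fun x => kap (choice.pickle x, B (choice.pickle x))) => X K' c.
have [F [k [FFF Fk]]] := largeB (\max_(x <- X) choice.pickle x).+1 K' c.
exists F, k; split=> // t tF; have [Bt ct] := Fk t tF; split=> // x xX.
rewrite -(hB _ _ _ _ Bt) /h ?choice.pickleK // ltnS.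
exact: leq_bigmax_seq.
Qed.

Hypothesis FF_nosingleton : forall n, ~ FF [fset n].
Hypothesis FF_nonempty : ~ FF fset0.

(** Give each point of [A] its own colour and all other points the colour [None]: a monochrome set
    meeting [A] would be a singleton. *)
Lemma large_avoid (S : set nat) (A : {fset nat}) :
  large S -> exists2 F, FF F & {in F, forall t, S t /\ t \notin A}.
Proof.
move=> /(_ _ (fun t => insub t : option A)) [F [[a|] [FFF Fa]]]; last first.
  exists F => // t tF; have [St /= tNone] := Fa t tF; split=> //.
  by case: insubP tNone.
have Fval t : t \in F -> t = val a.
  by move=> /Fa[_ /=]; case: insubP => // u _ <- [->].
case: (fset_0Vmem F) => [F0|[t tF]]; first by move: FFF; rewrite F0.
case: (@FF_nosingleton (val a)); suff <- : F = [fset val a] by [].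
apply/fsetP => x; rewrite inE; apply/idP/eqP => [/Fval //|->].
by rewrite -(Fval t tF).
Qed.

Definition box (Fs : seq {fset nat}) (ts : seq nat) : bool :=
  all2 (fun (F : {fset nat}) t => t \in F) Fs ts.

Lemma box_finite Fs : exists X : seq (seq nat), forall ts, box Fs ts -> ts \in X.
Proof.
elim: Fs => [|F Fs [X HX]]; first by exists [:: [::]]; case.
exists [seq t :: ts | t <- F, ts <- X] => - [//|t ts] /= /andP[tF bts].
by apply/allpairsP; exists (t, ts); split=> //; exact: HX.
Qed.

(** The tail box is chosen first, for the limit colouring [g]. It is finite, so one large set of [t]
    realises the limit on all of it, and [F] is taken there, away from [A] and the tail
    coordinates. *)
Lemma monochrome_box (K : finType) (n : nat) (C : seq nat -> K) (A : {fset nat}) :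
  partition_regular FF -> exists Fs k,
    [/\ size Fs = n, {in Fs, forall F, FF F}
      & forall ts, box Fs ts -> [/\ uniq ts, {in ts, forall t, t \notin A}
                                  & C ts = k]].
Proof.
move=> FF_pr; elim: n C => [|n IHn] C.
  by exists [::], (C [::]); split=> // - [].
have [g gP] := large_limit (fun ts t => C (t :: ts)) FF_pr.
have [Fs [k [sFs FFs Fsk]]] := IHn g.
have [X XP] := box_finite Fs.
have [F FFF FP] := large_avoid (A `|` [fset x in flatten X])%fset (gP X).
exists (F :: Fs), k; split; first by rewrite /= sFs.
  by move=> G; rewrite inE => /orP[/eqP->|/FFs].
case=> //= t ts /andP[tF bts]; have [uts tsA gk] := Fsk _ bts.
have [Ct] := FP t tF; rewrite !inE negb_or => /andP[tA tX].
have tsX := XP _ bts.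
split; last by rewrite Ct.
  rewrite uts andbT; apply: contra tX => tts.
  by apply/flattenP; exists ts.
by move=> x; rewrite inE => /orP[/eqP->|/tsA].
Qed.

End Large.

(** * Lines of located words with every letter doubled *)

Section LocatedLines.
Variables (Sigma : finType) (s0 : Sigma) (n : nat).

Lemma fnd_fmap_fun (A : {fset nat}) (f : nat -> Sigma) x :
  [fmap y : A => f (val y)].[? x]%fmap = if x \in A then Some (f x) else None.
Proof.
case: ifP => [xA|/negbT xA]; last by rewrite not_fnd.
by rewrite in_fnd ffunE.
Qed.

(* Letter number [j] of a word sits at the two positions [j] and [nth 0 ts j]. *)
Definition slot (ts : seq nat) (x : nat) : nat := if x < n then x else index x ts.

Definition slots (ts : seq nat) : {fset nat} := [fset x in iota 0 n ++ ts]%fset.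

Lemma in_slots ts x : (x \in slots ts) = (x < n) || (x \in ts).
Proof. by rewrite in_fset /= mem_cat mem_iota add0n. Qed.

Definition spread (ts : seq nat) (w : seq Sigma) : located_word Sigma :=
  [fmap x : slots ts => nth s0 w (slot ts (val x))].

Definition constant_part (ts : seq nat) (l : seq (option Sigma)) :
    located_word Sigma :=
  [fmap x : [fset x in slots ts | nth None l (slot ts x) != None]%fset =>
     odflt s0 (nth None l (slot ts (val x)))].

(** This becomes gamma: the second position of letter [i] is left out, to be replaced by [t]. *)
Definition variable_part (ts : seq nat) (l : seq (option Sigma)) (i : nat) :
    {fset nat} :=
  [fset x in slots ts | (nth None l (slot ts x) == None) && (x != nth 0 ts i)]%fset.

Lemma mem_set_nth (ts : seq nat) i t : t \in set_nth 0 ts i t.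
Proof.
have {1}-> : t = nth 0 (set_nth 0 ts i t) i by rewrite nth_set_nth /= eqxx.
by rewrite mem_nth // size_set_nth leq_max leqnn.
Qed.

Lemma index_set_nth (ts : seq nat) i t x : i < size ts ->
  x != t -> x != nth 0 ts i ->
  (x \in set_nth 0 ts i t) = (x \in ts) /\ index x (set_nth 0 ts i t) = index x ts.
Proof.
move=> + xt; elim: ts i => [|y ts IHts] [|i] //=.
  by move=> _ xy; rewrite !inE !(eq_sym _ x) (negbTE xt) (negbTE xy).
rewrite ltnS => /IHts H /H[E1 E2]; by rewrite !inE E1 E2.
Qed.

Lemma spread_line (ts : seq nat) (l : seq (option Sigma)) (i t : nat) (s : Sigma) :
    size l = n -> size ts = n -> i < n -> nth None l i = None ->
    uniq ts -> {in ts, forall x, n <= x} -> n <= t ->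
    uniq (set_nth 0 ts i t) ->
  spread (set_nth 0 ts i t) (line_at l s) =
  word_union (constant_part ts l)
    (const_word (variable_part ts l i `|` [fset t])%fset s).
Proof.
move=> sl sts lin li uts tsn tn uts'.
have sts' : size (set_nth 0 ts i t) = n.
  by rewrite size_set_nth sts; apply/maxn_idPr.
have nthl j : j < n -> nth s0 (line_at l s) j = odflt s (nth None l j).
  by move=> jn; rewrite (nth_map None) ?sl.
have tE : nth 0 (set_nth 0 ts i t) i = t by rewrite nth_set_nth /= eqxx.
apply/fmapP => x; rewrite /word_union fnd_cat.
rewrite (fnd_fmap_fun _ (fun x => nth s0 _ (slot _ x))).
rewrite (fnd_fmap_fun _ (fun x => odflt s0 (nth None l (slot ts x)))).
rewrite (fnd_fmap_fun _ (fun=> s)) /=.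
rewrite !(in_slots, inE).
have [->|xt] := eqVneq x t.
  rewrite orbT mem_set_nth orbT /slot ltnNge tn /=.
  by rewrite -[X in index X _]tE index_uniq ?sts' // nthl // li.
rewrite orbF /slot.
have [xn|nx] /= := ltnP x n.
  have xts : x != nth 0 ts i.
    by apply: contraTneq xn => ->; rewrite -leqNgt tsn // mem_nth // sts.
  by rewrite nthl // xts andbT; case: (nth None l x).
(* The abandoned position lies in neither domain, since [ts] has no repetitions. *)
have [xi|xi] := eqVneq x (nth 0 ts i).
  rewrite xi index_uniq ?sts // li /= andbF.
  rewrite ifN //; apply/negP => /(nthP 0)[j]; rewrite sts' => jn.
  rewrite nth_set_nth /=; case: eqP => [_ tE'|/eqP ji /eqP].
    by rewrite xi -tE' eqxx in xt.
  by rewrite nth_uniq ?sts // (negbTE ji).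
have [|-> ->] := @index_set_nth ts i t x _ xt xi; first by rewrite sts.
have [xts|//] /= := boolP (x \in ts).
rewrite nthl -?[X in _ < X]sts ?index_mem // andbT.
by case: (nth None l _).
Qed.

End LocatedLines.

(** * From a monochrome box and a Hales-Jewett line to the configuration *)

Theorem theorem3 (FF : set {fset nat}) (Sigma : finType)
    (FF_pr : partition_regular FF)
    (FF_nosingleton : forall n : nat, ~ FF [fset n]%fset)
    (Sigma_nonempty : 0 < #|Sigma|)
    (r : nat) (c : located_word Sigma -> 'I_r) :
  exists (alpha : located_word Sigma) (gamma : {fset nat}) (F : {fset nat}),
    [/\ gamma <> fset0, FF F,
        [/\ [disjoint domf alpha & gamma]%fset,
            [disjoint domf alpha & F]%fset
          & [disjoint gamma & F]%fset]
      & monochrome c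
          [set w | exists (s : Sigma) (t : nat),
             t \in F /\
             w = word_union alpha (const_word (gamma `|` [fset t])%fset s)]].
Proof.
(* With [F] empty there is nothing to colour. *)
have [FF0|FF_nonempty] := pselect (FF fset0).
  exists fmap0, [fset 0]%fset, fset0; split=> //.
  - by move/fsetP/(_ 0); rewrite !inE.
  - by split; rewrite ?fdisjoint0X ?fdisjointX0.
  - by exists (c fmap0) => w [s [t []]].
have /card_gt0P[s0 _] := Sigma_nonempty.
have [n HJ] := hales_jewett Sigma 'I_r.
(* The colour of [ts] records the colours of all words spread along it, so constancy on the box
   leaves dependence on the word alone. *)
pose C ts := [ffun w : n.-tuple Sigma => c (spread s0 n ts w)].
have [Fs [k [sFs FFs Fsk]]] :=
  monochrome_box FF_nosingleton FF_nonempty n C [fset x in iota 0 n]%fset FF_pr.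
have boxP ts : box Fs ts ->
    [/\ size ts = n, uniq ts, {in ts, forall x, n <= x} & C ts = k].
  move=> bts; have [uts tsn Ck] := Fsk ts bts; split=> //.
    by rewrite -sFs; move: bts; rewrite /box all2E => /andP[/eqP].
  by move=> x /tsn; rewrite !inE mem_iota /= add0n -leqNgt.
have [ts bts] : exists ts, box Fs ts.
  elim: Fs FFs {sFs Fsk boxP} => [|F Fs IHFs] FFs; first by exists [::].
  have [|ts bts] := IHFs; first by move=> G GFs; apply: FFs; rewrite inE GFs orbT.
  have [F0|[t tF]] := fset_0Vmem F; last by exists (t :: ts); rewrite /= tF.
  by have := FFs F (mem_head _ _); rewrite F0.
have [sts uts tsn Cts] := boxP ts bts.
have [l [sl Nl] monol] := HJ (fun w => c (spread s0 n ts w)).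
pose i := index None l.
have lin : i < n by rewrite -sl index_mem.
have li : nth None l i = None by exact: nth_index.
pose F := nth fset0 Fs i.
have FFF : FF F by apply: FFs; rewrite mem_nth // sFs.
have box_set t : t \in F -> box Fs (set_nth 0 ts i t).
  rewrite /F; move: lin bts; rewrite -sFs; move: (i).
  elim: (Fs) (ts) => [|G Gs IHGs] [|u us] [|j] //=.
    by move=> _ /andP[_ ->] ->.
  by rewrite ltnS => jG /andP[-> /IHGs] /(_ _ jG).
(* Replacing the [i]-th coordinate by [t] stays in the box, so it creates no repetition with the
   other coordinates and keeps clear of the first [n] positions. *)
have F_slots t : t \in F -> t \in slots n ts -> t = nth 0 ts i.
  move=> tF; have [sts' uts' tsn' _] := boxP _ (box_set _ tF).
  have tE : nth 0 (set_nth 0 ts i t) i = t by rewrite nth_set_nth /= eqxx.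
  rewrite in_slots ltnNge tsn' ?mem_set_nth //= => /(nthP 0)[j]; rewrite sts => jn jt.
  rewrite -jt; congr nth; apply/eqP.
  rewrite -(nth_uniq 0 _ _ uts') ?sts' // tE nth_set_nth /= jt.
  by case: ifP.
exists (constant_part s0 n ts l), (variable_part n ts l i), F; split=> //.
- move=> /fsetP/(_ i); rewrite !(in_slots, inE) /slot lin li /=.
  by rewrite eq_sym gtn_eqF // (leq_trans lin) // tsn // mem_nth ?sts.
- have var_F : [disjoint slots n ts `\ nth 0 ts i & F]%fset.
    apply/fdisjointP => x; rewrite in_fsetD1 => /andP[xi xs].
    by apply: contra_neqN xi => xF; exact: F_slots.
  split.
  + apply/fdisjointP => x; rewrite !(in_slots, inE) /= => /andP[_ lx].
    by rewrite (negbTE lx) andbF.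
  + apply: fdisjointWl var_F; apply/fsubsetP => x.
    rewrite !(in_slots, inE) => /andP[-> lx]; rewrite andbT.
    apply: contraNneq lx => ->.
    by rewrite /slot ltnNge tsn ?mem_nth ?sts //= index_uniq ?sts // li.
  + apply: fdisjointWl var_F; apply/fsubsetP => x.
    by rewrite !(in_slots, inE) => /and3P[-> _ ->].
(* Changing [t] keeps the colour by the box, changing [s] by the line. *)
- exists (c (spread s0 n ts (line_at l s0))) => w [s [t [tF ->]]].
  have [sts' uts' tsn' Cts'] := boxP _ (box_set _ tF).
  rewrite -(spread_line s0 _ sl sts) // ?tsn' ?mem_set_nth // -(monol s s0).
  have /eqP sw : size (line_at l s) = n by rewrite size_map.
  by have /ffunP/(_ (Tuple sw)) := etrans Cts' (esym Cts); rewrite !ffunE.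
Qed.
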